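(* Consider the networked system $\dot X=\Phi X$, $Y=\Psi X$ with $\Phi=I_N\otimes A+L\otimes H$ and $\Psi=\Delta\otimes C$, and let $\bar\Phi=I_N\otimes A+\bar L\otimes H$. If the topological change $L\to\bar L$ is $\Psi$-discernible for this networked system, then the following two conditions hold simultaneously: (1) $(A,H)$ is observable; (2) $(A+\lambda H,C)$ is observable for all $\lambda\in\sigma(L)\cup\sigma(\bar L)$.
   Context: Setting. $N\ge 2$; $A\in\mathbb R^{n\times n}$, $H\in\mathbb R^{n\times n}$, $C\in\mathbb R^{p\times n}$. $L=[w_{ij}]\in\mathbb R^{N\times N}$ is the weight matrix of a directed weighted graph on $N$ nodes, with $w_{ii}=0$ and $w_{ij}\ne 0$ exactly when there is an edge from node $j$ to node $i$ (weights are otherwise arbitrary real numbers). $\Delta=\mathrm{diag}\{\delta_1,\dots,\delta_N\}$ with $\delta_i=1$ if node $i$ is measured and $\delta_i=0$ otherwise. The networked system consists of $N$ nodes $\dot x_i=Ax_i+\sum_{j=1}^N w_{ij}Hx_j$, $y_i=Cx_i$, with stacked state $X=[x_1^T,\dots,x_N^T]^T\in\mathbb R^{Nn}$. A topological change replaces $L$ by another real $N\times N$ weight matrix $\bar L$ with zero diagonal (edges removed or added, or edge weights changed), giving the new system $\dot{\bar X}=\bar\Phi\bar X$, $\bar Y=\Psi\bar X$. $\otimes$ is the Kronecker product. Discernibility. A pair of initial states $(X_0,\bar X_0)\in\mathbb R^{Nn}\times\mathbb R^{Nn}$ is called $\Psi$-indiscernible with respect to $L\to\bar L$ if $\Psi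 e^{\Phi t}X_0=\Psi e^{\bar\Phi t}\bar X_0$ for all $t\ge 0$. The change $L\to\bar L$ is called $\Psi$-discernible if the only $\Psi$-indiscernible pair is the trivial one $(\mathbf 0_{Nn},\mathbf 0_{Nn})$; otherwise it is $\Psi$-indiscernible. Notation. $\sigma(\cdot)$ is the set of complex eigenvalues. A pair $(M,K)$ of complex matrices, $M$ square of size $n$ and $K$ with $n$ columns, is observable in the usual sense (state matrix first, output matrix second): the only $x\in\mathbb C^n$ with $KM^kx=0$ for $k=0,\dots,n-1$ is $x=0$; equivalently no eigenvector of $M$ lies in the null space of $K$. *)

(* Defs.v *)
From HB Require Import structures.
From mathcomp Require Import all_boot all_order all_algebra.
From mathcomp Require Import all_classical all_reals all_analysis.
From mathcomp Require Import complex mxtens.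

Set Implicit Arguments.
Unset Strict Implicit.
Unset Printing Implicit Defensive.

Import Order.TTheory GRing.Theory Num.Theory.
Import numFieldNormedType.Exports.

Local Open Scope classical_set_scope.
Local Open Scope ring_scope.

Definition complexmx (R : rcfType) (m n : nat) (A : 'M[R]_(m, n)) :
    'M[R[i]]_(m, n) :=
  map_mx (real_complex R) A.

(* The limit is taken for the (max-norm) topology of the space of matrices. *)
Definition expmx (R : realType) (n : nat) (M : 'M[R]_n) : 'M[R]_n :=
  limn (series (fun k : nat => (k`!%:R)^-1 *: M ^+ k)).

(* The state matrix is the first argument, the output matrix the second. *)
Definition observable (F : fieldType) (n p : nat)
    (M : 'M[F]_n) (K : 'M[F]_(p, n)) : Prop :=
  forall x : 'cV[F]_n,
    (forall k : nat, (k < n)%N -> K *m M ^+ k *m x = 0) -> x = 0.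

(* [eigenvalue] is defined in the library through row eigenvectors; over a
   field these are the same scalars as for column eigenvectors. *)
Definition spectrum (R : rcfType) (N : nat) (L : 'M[R]_N) : set R[i] :=
  [set l | eigenvalue (complexmx L) l].

(* [S] is the set of measured nodes. *)
Definition measureMx (R : realType) (N : nat) (S : {set 'I_N}) : 'M[R]_N :=
  diag_mx (\row_i (i \in S)%:R).

Definition netPhi (R : realType) (N n : nat) (A H : 'M[R]_n) (L : 'M[R]_N) :
    'M[R]_(N * n) :=
  (1%:M : 'M[R]_N) *t A + L *t H.

Definition netPsi (R : realType) (N n p : nat) (S : {set 'I_N})
    (C : 'M[R]_(p, n)) : 'M[R]_(N * p, N * n) :=
  measureMx R S *t C.

(* [L] has entry [w_ij] in row [i], column [j], nonzero exactly when there is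
   an edge from [j] to [i]; the matrix thus determines the graph, and the only
   constraint is the absence of self-loops. *)
Definition weight_matrix (R : realType) (N : nat) (L : 'M[R]_N) : Prop :=
  forall i, L i i = 0.

Section Discernibility.
Variables (R : realType) (N n p : nat).
Variables (A H : 'M[R]_n) (C : 'M[R]_(p, n)) (S : {set 'I_N}).
Variables (L Lbar : 'M[R]_N).

Definition indiscernible_pair (X0 Xbar0 : 'cV[R]_(N * n)) : Prop :=
  forall t : R, 0 <= t ->
    netPsi S C *m expmx (t *: netPhi A H L) *m X0 =
    netPsi S C *m expmx (t *: netPhi A H Lbar) *m Xbar0.

Definition discernible : Prop :=
  forall X0 Xbar0 : 'cV[R]_(N * n),
    indiscernible_pair X0 Xbar0 -> X0 = 0 /\ Xbar0 = 0.

End Discernibility.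

(* Main.v *)
Require Import Defs.
From HB Require Import structures.
From mathcomp Require Import all_boot all_order all_algebra.
From mathcomp Require Import all_classical all_reals all_analysis.
From mathcomp Require Import complex mxtens.

(** If either observability condition fails, an unobservable vector [x] of the
    node dynamics produces a nontrivial indiscernible pair, of the form
    [v *t x] with [v] a vector of node weights.

    If [(A, H)] is not observable, take [x <> 0] with [H A^k x = 0] for all
    [k].  A network started at [v *t x] then never exchanges anything: its
    coupling term [L *t H] vanishes along the whole trajectory, so
    [Phi^k (v *t x) = v *t (A^k x)] whatever [L] is
    ([kron_pow_unobservable]).  The two networks have the same trajectory from
    [v *t x], and this state paired with itself is indiscernible.

    If [(A + l H, C)] is not observable for an eigenvalue [l] of [L], take an
    eigenvector [v] of [L] and [x <> 0] with [C (A + l H)^k x = 0] for all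
    [k].  The vectors [v *t y] form an invariant subspace of [Phi], on which it
    acts as [A + l H] ([kron_pow_eigenvector]), so the output of the network
    started at [v *t x] is identically zero, and [(v *t x, 0)] is
    indiscernible.  An eigenvalue of [Lbar] gives [(0, v *t x)] instead.

    These vectors are complex, whereas discernibility speaks of real initial
    states and of matrix exponentials.  [discernible_complex] bridges the gap:
    real and imaginary parts of a complex pair are again pairs of the same
    kind, and outputs that agree on all powers of the state matrices agree on
    their exponentials, because [M |-> P M X] is continuous and the exponential
    series converges ([eq_mulmx_expmx]). *)

Set Implicit Arguments.
Unset Strict Implicit.
Unset Printing Implicit Defensive.

Import Order.TTheory GRing.Theory Num.Theory.
Import numFieldNormedType.Exports.

Local Open Scope classical_set_scope.
Local Open Scope ring_scope.

(** * Matrix exponential *)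

(** Completeness of matrix spaces over the reals, joined here to their norm:
    absolutely convergent series of matrices converge. *)
HB.instance Definition _ (R : realType) m n :=
  Uniform_isComplete.Build 'M[R]_(m, n) cauchy_cvg.

(** The norm is the largest modulus of an entry, and each entry of the product
    is a sum of [n] products; hence the factor [n]. *)
Lemma mx_normM (R : realType) m n p (A : 'M[R]_(m, n)) (B : 'M[R]_(n, p)) :
  `|A *m B| <= n%:R * `|A| * `|B|.
Proof.
have entry_le q r (M : 'M[R]_(q, r)) i j : `|M i j| <= `|M|.
  rewrite [leRHS]/Num.Def.normr /= mx_normrE.
  by apply: (le_bigmax _ (fun ij : 'I_q * 'I_r => `|M ij.1 ij.2|) (i, j)).
rewrite [leLHS]/Num.Def.normr /= mx_normrE.
apply: bigmax_le => [|[i j] _ /=]; first by rewrite !mulr_ge0.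
rewrite mxE (le_trans (ler_norm_sum _ _ _)) //.
rewrite -mulrA -[n in n%:R]card_ord mulr_natl -sumr_const ler_sum // => k _.
by rewrite normrM ler_pM.
Qed.

(** The scalar exponential series of [n * |M|] dominates: the factor [n] of
    [mx_normM] occurs once per multiplication by [M]. *)
Lemma is_cvg_series_expmx (R : realType) n (M : 'M[R]_n) :
  cvgn (series (fun k => (k`!%:R)^-1 *: M ^+ k)).
Proof.
apply: normed_cvg.
apply: (@series_le_cvg _ _ (exp_coeff (n%:R * `|M|))).
- by move=> k; exact: normr_ge0.
- by move=> k; apply: exp_coeff_ge0; rewrite mulr_ge0.
- move=> k /=; rewrite normrZ ger0_norm ?invr_ge0 // mulrC /exp_coeff /=.
  rewrite ler_wpM2r ?invr_ge0 //; elim: k => [|k IHk].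
    rewrite !expr0 [leLHS]/Num.Def.normr /= mx_normrE.
    apply: bigmax_le => // -[i j] _ /=; rewrite mxE.
    by case: eqP => _; rewrite ?normr1 ?normr0.
  by rewrite !exprS (le_trans (mx_normM _ _)) // ler_wpM2l.
- exact: is_cvg_series_exp_coeff.
Qed.

Lemma cvg_mulmx_expmx (R : realType) m n p (P : 'M[R]_(m, n)) (M : 'M[R]_n)
    (X : 'M[R]_(n, p)) :
  series (fun k => (k`!%:R)^-1 *: (P *m M ^+ k *m X)) @ \oo -->
    P *m expmx M *m X.
Proof.
have mul_cont : continuous (mulmxr X \o mulmx P : 'M[R]_n -> 'M[R]_(m, p)).
  move=> Z; apply: continuous_comp; apply: bounded_linear_continuous.
    apply/linear_boundedP; near=> r => Y.
    by rewrite (le_trans (mx_normM _ _)) // ler_wpM2r.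
  apply/linear_boundedP; near=> r => Y.
  by rewrite (le_trans (mx_normM _ _)) // mulrAC ler_wpM2r.
set S := series (fun k => (k`!%:R)^-1 *: M ^+ k).
rewrite (_ : series _ = (mulmxr X \o mulmx P) \o S).
  exact: continuous_cvg (mul_cont _) (@is_cvg_series_expmx _ _ M).
apply/funext => k; rewrite /= /S /series /= mulmx_sumr mulmx_suml.
by apply: eq_bigr => i _; rewrite -scalemxAr -scalemxAl.
Unshelve. all: by end_near. Qed.

(** Term by term, the two sides are limits of the same series. *)
Lemma eq_mulmx_expmx (R : realType) m n p (P : 'M[R]_(m, n))
    (M1 M2 : 'M[R]_n) (X1 X2 : 'M[R]_(n, p)) (t : R) :
    (forall k, P *m M1 ^+ k *m X1 = P *m M2 ^+ k *m X2) ->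
  P *m expmx (t *: M1) *m X1 = P *m expmx (t *: M2) *m X2.
Proof.
have scaleX (M : 'M[R]_n) k : (t *: M) ^+ k = t ^+ k *: M ^+ k.
  elim: k => [|k IHk]; first by rewrite !expr0 scale1r.
  rewrite !exprS IHk; transitivity ((t *: M) *m (t ^+ k *: M ^+ k)) => //.
  by rewrite -scalemxAl -scalemxAr scalerA.
move=> eq_pow.
have cvg1 := @cvg_mulmx_expmx _ _ _ _ P (t *: M1) X1.
have := @cvg_mulmx_expmx _ _ _ _ P (t *: M2) X2.
rewrite (_ : series _ =
    series (fun k => k`!%:R^-1 *: (P *m (t *: M1) ^+ k *m X1))).
  exact: cvg_unique cvg1.
congr series; apply/funext => k.
by rewrite !scaleX -!scalemxAr -!scalemxAl eq_pow.
Qed.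

(** * Real and imaginary parts *)

(* [Re] and [Im] are additive for the real vector space structure of the
   complex numbers, which is carried by the alias [Rcomplex R]. *)

Lemma map_Re_mulmx (R : rcfType) m n p (A : 'M[R]_(m, n))
    (X : 'M[R[i]]_(n, p)) :
  map_mx (@complex.Re R) (complexmx A *m X) = A *m map_mx (@complex.Re R) X.
Proof.
apply/matrixP => i j; rewrite !mxE (@raddf_sum (Rcomplex R)).
apply: eq_bigr => k _; rewrite !mxE; case: (X k j) => a b /=.
by rewrite mul0r subr0.
Qed.

Lemma map_Im_mulmx (R : rcfType) m n p (A : 'M[R]_(m, n))
    (X : 'M[R[i]]_(n, p)) :
  map_mx (@complex.Im R) (complexmx A *m X) = A *m map_mx (@complex.Im R) X.
Proof.
apply/matrixP => i j; rewrite !mxE (@raddf_sum (Rcomplex R)).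
apply: eq_bigr => k _; rewrite !mxE; case: (X k j) => a b /=.
by rewrite mul0r addr0.
Qed.

Lemma complexmxX (R : rcfType) n (A : 'M[R]_n) k :
  complexmx (A ^+ k) = complexmx A ^+ k.
Proof.
elim: k => [|k IHk]; first by rewrite !expr0 /complexmx map_mx1.
by rewrite !exprS -IHk; exact: map_mxM.
Qed.

(** The form in which discernibility is used: complex initial states, and
    powers of the state matrices in place of their exponentials. *)
Lemma discernible_complex (R : realType) (N n p : nat)
    (A H : 'M[R]_n) (C : 'M[R]_(p, n)) (S : {set 'I_N}) (L Lbar : 'M[R]_N)
    (X Xbar : 'cV[R[i]]_(N * n)) :
    discernible A H C S L Lbar ->
    (forall k,
      complexmx (netPsi S C) *m complexmx (netPhi A H L) ^+ k *m X =
      complexmx (netPsi S C) *m complexmx (netPhi A H Lbar) ^+ k *m Xbar) ->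
  X = 0 /\ Xbar = 0.
Proof.
move=> disc eqX.
have [ReX0 ReXbar0] : map_mx (@complex.Re R) X = 0
    /\ map_mx (@complex.Re R) Xbar = 0.
  apply: disc => t _; apply: eq_mulmx_expmx => k.
  have := congr1 (map_mx (@complex.Re R)) (eqX k).
  by rewrite -!complexmxX -!mulmxA !map_Re_mulmx.
have [ImX0 ImXbar0] : map_mx (@complex.Im R) X = 0
    /\ map_mx (@complex.Im R) Xbar = 0.
  apply: disc => t _; apply: eq_mulmx_expmx => k.
  have := congr1 (map_mx (@complex.Im R)) (eqX k).
  by rewrite -!complexmxX -!mulmxA !map_Im_mulmx.
have eq0 (Y : 'cV[R[i]]_(N * n)) : map_mx (@complex.Re R) Y = 0 ->
    map_mx (@complex.Im R) Y = 0 -> Y = 0.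
  move=> /matrixP ReY /matrixP ImY; apply/matrixP => i j.
  apply/eqP; rewrite eq_complex; move: (ReY i j) (ImY i j).
  by rewrite !mxE => -> ->; rewrite !eqxx.
by split; apply: eq0.
Qed.

(** * Kronecker products *)

Lemma tensmx_eq0 (F : fieldType) m n (v : 'cV[F]_m) (x : 'cV[F]_n) :
  v *t x = 0 -> v != 0 -> x = 0.
Proof.
move=> /matrixP vx0 /cV0Pn [i vi]; apply/matrixP => j k.
have := vx0 (mxtens_index (i, j)) (mxtens_index (ord0, ord0)).
rewrite tensmxE !ord1 !mxE => /eqP; rewrite mulf_eq0 (negPf vi) /=.
by move=> /eqP.
Qed.

Lemma complex_netPhi (R : realType) N n (A H : 'M[R]_n) (L : 'M[R]_N) :
  complexmx (netPhi A H L) =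
    1%:M *t complexmx A + complexmx L *t complexmx H.
Proof. by rewrite /complexmx /netPhi map_mxD !map_mxT map_mx1. Qed.

Lemma complex_netPsi (R : realType) N n p S (C : 'M[R]_(p, n)) :
  complexmx (@netPsi R N n p S C) =
    complexmx (measureMx R S) *t complexmx C.
Proof. by rewrite /complexmx /netPsi map_mxT. Qed.

(** On [v *t _] the factor [L] acts as the scalar [l], which can be moved to
    the second factor. *)
Lemma kron_pow_eigenvector (F : fieldType) N n (A H : 'M[F]_n) (L : 'M[F]_N)
    (v : 'cV[F]_N) (x : 'cV[F]_n) (l : F) k :
    L *m v = l *: v ->
  (1%:M *t A + L *t H) ^+ k *m (v *t x) = v *t ((A + l *: H) ^+ k *m x).
Proof.
move=> Lv; elim: k => [|k IHk]; first by rewrite !expr0 !mul1mx.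
rewrite !exprS -!mulmxE -!mulmxA IHk mulmxDl !tensmx_mul mul1mx Lv.
apply/matrixP => i j; case: (mxtens_indexP i) => i1 i2.
case: (mxtens_indexP j) => j1 j2; rewrite mulmxDl -scalemxAl mxE !tensmxE !mxE.
by rewrite mulrDr mulrCA mulrA.
Qed.

(** Every iterate is [v *t (A^j x)], which [L *t H] kills; so the right-hand
    side does not involve [L]. *)
Lemma kron_pow_unobservable (F : fieldType) N n (A H : 'M[F]_n) (L : 'M[F]_N)
    (v : 'cV[F]_N) (x : 'cV[F]_n) k :
    (forall j, H *m A ^+ j *m x = 0) ->
  (1%:M *t A + L *t H) ^+ k *m (v *t x) = v *t (A ^+ k *m x).
Proof.
move=> HAx0; elim: k => [|k IHk]; first by rewrite !expr0 !mul1mx.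
rewrite !exprS -!mulmxE -!mulmxA IHk mulmxDl !tensmx_mul mul1mx.
by rewrite [H *m _]mulmxA HAx0 tensmx0 addr0.
Qed.

(** * Observability *)

(** By Cayley-Hamilton, every power of [M] is a combination of the powers below
    [n]: reduce ['X^k] modulo the characteristic polynomial. *)
Lemma observability_all_powers (F : fieldType) n p (M : 'M[F]_n)
    (K : 'M[F]_(p, n)) (x : 'cV[F]_n) :
    (forall k, (k < n)%N -> K *m M ^+ k *m x = 0) ->
  forall k, K *m M ^+ k *m x = 0.
Proof.
case: n M K x => [|n] M K x Kx0 k; first by rewrite [x]flatmx0 mulmx0.
rewrite -[M in M ^+ k]horner_mx_X -rmorphXn /=.
rewrite (divp_eq 'X^k (char_poly M)) rmorphD rmorphM /=.
rewrite Cayley_Hamilton mulr0 add0r.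
set r := 'X^k %% char_poly M.
have size_r : (size r <= n.+1)%N.
  by rewrite -ltnS -(size_char_poly M) ltn_modp monic_neq0 ?char_poly_monic.
rewrite -(coefK r) poly_def rmorph_sum /= mulmx_sumr mulmx_suml big1 // => i _.
rewrite horner_mxZ rmorphXn /= horner_mx_X -scalemxAr -scalemxAl.
rewrite Kx0 ?scaler0 //; exact: leq_trans (ltn_ord i) size_r.
Qed.

(** Row eigenvectors become column eigenvectors because a square matrix and its
    transpose have the same rank. *)
Lemma spectrum_eigenvector (R : rcfType) N (L : 'M[R]_N) (l : R[i]) :
  spectrum L l -> exists2 v : 'cV_N, v != 0 & complexmx L *m v = l *: v.
Proof.
rewrite /spectrum /= /eigenvalue /eigenspace => ker_neq0.
have : ~~ row_free (complexmx L - l%:M)^T.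
  by rewrite /row_free mxrank_tr -/(row_free _) -kermx_eq0.
rewrite -kermx_eq0 => /rowV0Pn [v /sub_kermxP v_ker v_neq0].
exists v^T; first by rewrite -(inj_eq trmx_inj) trmxK trmx0.
apply/eqP; rewrite -subr_eq0 -mul_scalar_mx -mulmxBl; apply/eqP.
by apply: trmx_inj; rewrite trmx_mul trmxK v_ker trmx0.
Qed.

Theorem corollary4 (R : realType) (N n p : nat) (hN : (2 <= N)%N)
    (A H : 'M[R]_n) (C : 'M[R]_(p, n)) (S : {set 'I_N})
    (L Lbar : 'M[R]_N)
    (hL : weight_matrix L) (hLbar : weight_matrix Lbar)
    (hdisc : discernible A H C S L Lbar) :
  observable (complexmx A) (complexmx H) /\
  (forall l : R[i], (spectrum L `|` spectrum Lbar) l ->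
     observable (complexmx A + l *: complexmx H) (complexmx C)).
Proof.
split=> [x Hx0 | l spec_l x Cx0].
  have HAx0 := observability_all_powers Hx0.
  (* Any nonzero [v] would do; it exists because the network has a node. *)
  pose v : 'cV[R[i]]_N := const_mx 1.
  have [|/tensmx_eq0 -> //] := @discernible_complex _ _ _ _ _ _ _ _ _ _
    (v *t x) (v *t x) hdisc.
    by move=> k; rewrite -!mulmxA !complex_netPhi !kron_pow_unobservable.
  by apply/cV0Pn; exists (Ordinal (ltnW hN)); rewrite mxE oner_neq0.
have unobservable (G : 'M[R]_N) (v : 'cV_N) k :
    complexmx G *m v = l *: v ->
    complexmx (netPsi S C) *m complexmx (netPhi A H G) ^+ k *m (v *t x) = 0.
  move=> Gv; rewrite -mulmxA complex_netPhi (kron_pow_eigenvector _ _ _ _ Gv).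
  by rewrite complex_netPsi tensmx_mul mulmxA observability_all_powers ?tensmx0.
case: spec_l => /spectrum_eigenvector [v v_neq0 Gv].
  have [|/tensmx_eq0 -> //] := @discernible_complex _ _ _ _ _ _ _ _ _ _
    (v *t x) 0 hdisc.
  by move=> k; rewrite unobservable // mulmx0.
have [|_ /tensmx_eq0 -> //] := @discernible_complex _ _ _ _ _ _ _ _ _ _
  0 (v *t x) hdisc.
by move=> k; rewrite unobservable // mulmx0.
Qed.
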